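(* Let $(X,d)$ be a metric space with at least three points. Then, for every positive integer $k$: (i) if $\dim_k(X) < +\infty$ then $\dim_k(X) < \dim_{k+1}(X)$; (ii) if $\dim_k(X) = +\infty$ then $\dim_{k+1}(X) = +\infty$. In particular, $\dim_k(X) + 1 \geq \dim_1(X) + k$ for every positive integer $k$.
   Context: For a set $A$, $|A|$ denotes its cardinality if $A$ is finite, and $|A| = +\infty$ if $A$ is infinite. For a metric space $(X,d)$ and a positive integer $k$, a subset $S\subset X$ is a $k$-metric generator for $X$ if for any two distinct points $u,v\in X$ there are at least $k$ distinct points $w\in S$ with $d(u,w)\neq d(v,w)$. The $k$-metric dimension $\dim_k(X)$ is the infimum of $|S|$ over all $k$-metric generators $S$ for $X$, with the convention $\inf\varnothing = +\infty$; so $\dim_k(X)\in\{0,1,2,\ldots\}\cup\{+\infty\}$, and $\dim_k(X)=+\infty$ if and only if no finite subset of $X$ is a $k$-metric generator. Usual conventions for $+\infty$ apply ($+\infty + a = +\infty$, and $a<+\infty$ for every integer $a$). *)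

(* Defs.v *)
From mathcomp Require Import all_boot all_order all_algebra.
From mathcomp Require Import all_classical all_reals all_analysis.

Set Implicit Arguments.
Unset Strict Implicit.
Unset Printing Implicit Defensive.

Import Order.TTheory GRing.Theory Num.Theory.

Local Open Scope classical_set_scope.
Local Open Scope card_scope.
Local Open Scope ring_scope.

Definition metric_generator (R : realType) (X : metricType R) (k : nat)
    (S : set X) : Prop :=
  forall u v : X, u <> v ->
    `I_k #<= [set w | S w /\ mdist u w <> mdist v w].

(* [counting S] is the number of elements of S, or +oo when S is infinite;
   [ereal_inf set0] is +oo. *)
Definition metric_dim (R : realType) (X : metricType R) (k : nat) : \bar R :=
  ereal_inf [set counting S | S in [set S : set X | metric_generator k S]].

(* Main.v *)
Require Import Defs.
From mathcomp Require Import finmap.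
From mathcomp Require Import all_boot all_order all_algebra.
From mathcomp Require Import all_classical all_reals all_analysis.

Set Implicit Arguments.
Unset Strict Implicit.
Unset Printing Implicit Defensive.

Import Order.TTheory GRing.Theory Num.Theory.

Local Open Scope classical_set_scope.
Local Open Scope card_scope.
Local Open Scope ring_scope.
Local Open Scope ereal_scope.

(* Deleting any point from a finite (k+1)-metric generator leaves a k-metric
   generator, so dim_k X + 1 <= dim_(k+1) X; everything else follows. *)

(** Deleting a point from a (k+1)-generator costs each pair at most one separating point, so a
    k-generator remains ([metric_generator_setD1]). A pair of distinct points forces a
    (k+1)-generator to be nonempty, so a deletion is possible and lowers its size by one; passing to
    infima gives [metric_dim_succ]. Strict growth, propagation of [+oo] and, by induction, the
    linear bound follow. *)

Lemma card_ge_II_neq0 (T : Type) (A : set T) (k : nat) :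
  `I_k.+1 #<= A -> A !=set0.
Proof.
move=> IA; apply/set0P/negP => /eqP A0; move: IA.
by rewrite A0 card_le0 => /eqP/seteqP[/(_ 0%N) + _]; exact.
Qed.

(** As [A] may be infinite, the counting is done in a subset [C] with exactly [k.+1] elements, which
    loses at most one whether or not it contains [p]. *)
Lemma card_ge_II_setD1 (T : choiceType) (A : set T) (p : T) (k : nat) :
  `I_k.+1 #<= A -> `I_k #<= A `\ p.
Proof.
move=> /card_subP[C CI CA].
have finC : finite_set C by apply/finite_setP; exists k.+1.
have [n Dn] := (finite_setP (C `\ p)).1 (finite_setD [set p] finC).
have kn : (k <= n)%N.
  rewrite -(card_fset_set Dn) fset_setD1// -ltnS -(card_fset_set CI).
  by rewrite (cardfsD1 p (fset_set C)) -add1n leq_add2r leq_b1.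
have: `I_k #<= C `\ p by rewrite (card_le_eqr Dn) card_le_II.
by move=> /card_le_trans; apply; apply: subset_card_le; exact: setSD.
Qed.

Lemma metric_generator_setD1 (R : realType) (X : metricType R) (k : nat)
    (S : set X) (p : X) :
  metric_generator k.+1 S -> metric_generator k (S `\ p).
Proof.
move=> genS u v /genS /(card_ge_II_setD1 p) /card_le_trans; apply.
by apply: subset_card_le => w /= [[Sw duv] wp].
Qed.

(** For infinite [S] both sides are [+oo]; deleting one point cannot change finiteness, so the mixed
    cases are absurd. *)
Lemma counting_setD1 (R : realType) (T : choiceType) (S : set T) (p : T) :
  S p -> counting (S `\ p) + 1 = counting S :> \bar R.
Proof.
move=> Sp; rewrite /counting.
case: asboolP => [finD|infD]; case: asboolP => [finS|infS] //.
- rewrite fset_setD1// (cardfsD1 p (fset_set S)) in_fset_set// mem_set//.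
  by rewrite -EFinD addnC natrD.
- by case: infS; rewrite -(setD1K Sp) finite_setU; split.
- by case: infD; exact: finite_setD.
Qed.

Lemma counting_ge0 (R : realType) (T : choiceType) (S : set T) :
  0 <= counting S :> \bar R.
Proof. by rewrite /counting; case: ifP => _ //; rewrite lee_fin. Qed.

(** Rules out [-oo], so a dimension below [+oo] is a real number. *)
Lemma metric_dim_ge0 (R : realType) (X : metricType R) (k : nat) :
  0 <= metric_dim X k.
Proof.
by apply: le_ereal_inf_tmp => _ [S _ <-]; exact: counting_ge0.
Qed.

Lemma metric_dim_succ (R : realType) (X : metricType R) (u v : X) (k : nat) :
  u <> v -> metric_dim X k + 1 <= metric_dim X k.+1.
Proof.
move=> uv; apply: le_ereal_inf_tmp => _ [S /= genS <-].
(* The point to delete is one that separates [u] from [v]. *)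
have [p [Sp _]] := card_ge_II_neq0 (genS _ _ uv).
rewrite -(counting_setD1 R Sp) leeD2r//; apply: ereal_inf_lbound.
by exists (S `\ p) => //; exact: metric_generator_setD1.
Qed.

Theorem theorem3p1 (R : realType) (X : metricType R)
    (hX : `I_3 #<= [set: X]) :
  (forall k : nat, (0 < k)%N ->
    (metric_dim X k < +oo -> metric_dim X k < metric_dim X k.+1) /\
    (metric_dim X k = +oo -> metric_dim X k.+1 = +oo)) /\
  (forall k : nat, (0 < k)%N ->
    metric_dim X k + 1 >= metric_dim X 1 + k%:R%:E).
Proof.
have [u _] := card_ge_II_neq0 hX.
have [v [_ vu]] := card_ge_II_neq0 (card_ge_II_setD1 u hX).
have dimS k := metric_dim_succ k vu.
split.
- move=> k _; split=> [dim_fin|dim_oo].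
  (* Adding 1 is a strict increase because the dimension is a finite real. *)
  + have : metric_dim X k < metric_dim X k + 1.
      by rewrite lteDl ?lte01// ge0_fin_numE// metric_dim_ge0.
    by move=> /lt_le_trans; apply.
  + by apply/eqP; rewrite -leye_eq -[+oo](addye (x := 1))// -dim_oo.
(* Induction starts at index 1, where both sides coincide; each step gains 1 by [dimS]. *)
- case=> // k _; elim: k => [|k IH]; first exact: lexx.
  rewrite -natr1 EFinD addeA; apply: leeD2r.
  exact: le_trans IH (dimS _).
Qed.
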